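(* Fix a cardinal $\kappa<\mathfrak s$. If $\lambda$ is a cardinal with $\lambda<\mathfrak s$, then the family of all sequentially compact topological spaces having weight not greater than $\kappa$ is $\lambda$-ssc.
   Context: $[\omega]^\omega$ is the set of all infinite subsets of $\omega$. A sequence $x=\langle x_n:n<\omega\rangle$ converges along $H\in[\omega]^\omega$ if the subsequence $\langle x_n:n\in H\rangle$ converges. A family (possibly a proper class) $\mathcal F$ of topological spaces is $\lambda$-ssc if for any $\lambda$-many sequences, each with values in one of the spaces in $\mathcal F$ (possibly different spaces for different sequences), there is $H\in[\omega]^\omega$ such that each of these sequences converges along $H$. A family $\mathcal S\subseteq[\omega]^\omega$ is splitting if for every $A\in[\omega]^\omega$ there is $S\in\mathcal S$ with $A\cap S$ and $A\setminus S$ both infinite; $\mathfrak s$ is the least cardinality of a splitting family. The weight is $w(X)=\aleph_0+\min\{|\mathcal B|:\mathcal B\text{ is a basis for the topology on }X\}$. *)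

(* Defs.v *)
From mathcomp Require Import all_boot.
From mathcomp Require Import all_classical.
From mathcomp Require Import topology.

Set Implicit Arguments.
Unset Strict Implicit.
Unset Printing Implicit Defensive.

Local Open Scope classical_set_scope.
Local Open Scope card_scope.

Reserved Notation "A '#<' B" (at level 79, format "A  '#<'  B").

(* Cardinals are handled through representatives: a cardinal is a set or type
   considered up to equipotence. *)
Definition card_lt T U (A : set T) (B : set U) : Prop :=
  A #<= B /\ ~ (B #<= A).
Notation "A '#<' B" := (card_lt A B) : card_scope.

Definition card_add T U (A : set T) (B : set U) : set (T + U) :=
  inl @` A `|` inr @` B.

(* A member of P of least cardinality, representing min {|A| : A in P}
   (see [min_cardP]; the value is irrelevant when P is empty). *)
Definition min_card T (P : set (set T)) : set T :=
  xget set0 [set A | P A /\ forall B, P B -> A #<= B].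

Lemma min_cardP T (P : set (set T)) : P !=set0 ->
  P (min_card P) /\ forall B, P B -> min_card P #<= B.
Proof.
move=> [A0 PA0].
apply: (@xgetPex _ set0 [set A | P A /\ forall B, P B -> A #<= B]).
pose Q (F : set (set T -> T)) :=
  (forall f, F f -> forall A, P A -> A (f A)) /\
  (forall f g A, F f -> F g -> P A -> f A = g A -> f = g).
have [F [[Fin Finj] Fmax]] : exists F, Q F /\ forall G, F `<` G -> ~ Q G.
  apply: Zorn_bigcup => /= C CQ Ctot; split.
    by move=> f [F CF Ff]; have [+ _] := CQ _ CF; exact.
  move=> f g A [F CF Ff] [G CG Gg].
  have [FG|GF] := Ctot _ _ CF CG.
    by have [_ +] := CQ _ CG; apply=> //; exact: FG.
  by have [_ +] := CQ _ CF; apply=> //; exact: GF.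
have [A PA AF] : exists2 A, P A & forall a, A a -> exists2 f, F f & f A = a.
  apply: contrapT => noA.
  have new A : P A -> exists a, A a /\ forall f, F f -> f A <> a.
    move=> PA; apply: contrapT => noa; apply: noA; exists A => // a Aa.
    apply: contrapT => nof; apply: noa; exists a; split=> // f Ff fAa.
    by apply: nof; exists f.
  have [t0 _] := new _ PA0.
  have [c cP] : {c : set T -> T & forall A, P A ->
      A (c A) /\ forall f, F f -> f A <> c A}.
    apply: (@choice _ _ (fun A a => P A -> A a /\ forall f, F f -> f A <> a)).
    move=> A; have [/new[a aP]|nPA] := pselect (P A); first by exists a.
    by exists t0.
  apply: (Fmax (F `|` [set c])).
    split; first by move=> f; left.
    move=> /(_ c (or_intror erefl)) Fc.
    by have [_ /(_ c Fc)] := cP _ PA0; exact.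
  split; first by move=> f [/Fin//|->] A PA; have [] := cP _ PA.
  move=> f g A [Ff|->] [Fg|->] PA //; first exact: (Finj _ _ A).
  - by have [_ /(_ f Ff)] := cP _ PA.
  - by have [_ /(_ g Fg) gc] := cP _ PA => /esym.
exists A; split=> // B PB.
have [h hP] : {h : T -> T & forall a, A a ->
    exists2 f, F f & f A = a /\ f B = h a}.
  apply: (@choice _ _ (fun a b => A a ->
    exists2 f, F f & f A = a /\ f B = b)) => a.
  have [/AF[f Ff fAa]|nAa] := pselect (A a); last by exists a.
  by exists (f B) => _; exists f.
suff [f] : $|{injfun A >-> B}| by exact: inj_card_le f.
apply/injfunPex; exists h.
  by move=> a /hP[f Ff [_ <-]]; exact: (Fin f).
move=> a b /set_mem/hP[f Ff [<- <-]] /set_mem/hP[g Fg [<- <-]] fg.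
by rewrite (Finj _ _ _ Ff Fg PB fg).
Qed.

Definition splitting (S : set (set nat)) : Prop :=
  S `<=` [set A | infinite_set A] /\
  forall A, infinite_set A ->
    exists2 B, S B & infinite_set (A `&` B) /\ infinite_set (A `\` B).

Lemma splitting_infinite : splitting [set A | infinite_set A].
Proof.
split=> // A /infiniteP /pcard_leP[f].
have infI (g : nat -> nat) : injective g ->
    infinite_set [set f (g n) | n in [set: nat]].
  move=> ginj; apply/infiniteP.
  suff [h] : $|{injfun [set: nat] >-> [set f (g n) | n in [set: nat]]}|.
    exact: inj_card_le h.
  apply/injfunPex; exists (f \o g); first by move=> n _; exists n.
  by move=> m n _ _ /= /(inj (mem_set I) (mem_set I)) /ginj.
have inj2 : injective double by exact: double_inj.
have inj2S : injective (fun n => n.*2.+1) by move=> m n [] /double_inj.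
exists [set f n.*2 | n in [set: nat]]; first exact: infI inj2.
split; [apply: sub_infinite_set (infI _ inj2)
       | apply: sub_infinite_set (infI _ inj2S)].
  by move=> _ [n _ <-]; split; [exact: funS | exists n].
move=> _ [n _ <-]; split; first exact: funS.
move=> [m _ /(inj (mem_set I) (mem_set I))] /(congr1 odd).
by rewrite /= !odd_double.
Qed.

Definition splitting_number : set (set nat) := min_card splitting.

Lemma splitting_numberP : splitting splitting_number /\
  forall S, splitting S -> splitting_number #<= S.
Proof. by apply: min_cardP; eexists; exact: splitting_infinite. Qed.

Definition weight (X : topologicalType) : set (nat + set X) :=
  card_add [set: nat] (min_card (@basis X)).
Arguments weight X : clear implicits.

Lemma basis_open (X : topologicalType) : basis [set U : set X | open U].
Proof.
split=> // x A; rewrite nbhsE => -[U [oU Ux] UA].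
by exists U => //; split.
Qed.

Lemma min_card_basisP (X : topologicalType) : basis (min_card (@basis X)) /\
  forall B : set (set X), basis B -> min_card (@basis X) #<= B.
Proof. by apply: min_cardP; eexists; exact: basis_open. Qed.

(* The library's [cvg] needs a pointed codomain, hence the explicit limit.
   For infinite H the filter [within H \oo] is the filter of final segments of
   the index set H of the subsequence. *)
Definition converges_along (X : topologicalType) (x : nat -> X) (H : set nat) :
    Prop :=
  exists l : X, x @ within H \oo --> l.

Definition seq_compact (X : topologicalType) : Prop :=
  forall x : nat -> X, exists2 H, infinite_set H & converges_along x H.

(* A family of spaces is a predicate on [topologicalType], so it may be a proper
   class; the cardinal lambda is represented by the index type L. *)
Definition ssc (L : Type) (F : topologicalType -> Prop) : Prop :=
  forall (X : L -> topologicalType) (x : forall i, nat -> X i),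
    (forall i, F (X i)) ->
    exists2 H, infinite_set H & forall i, converges_along (x i) H.

(* Main.v *)
Require Import Defs.
From mathcomp Require Import all_boot.
From mathcomp Require Import all_classical.
From mathcomp Require Import topology.

(** Let the sequences [x i] take values in sequentially compact spaces [X i],
    and give each [X i] a basis of size at most [kappa]. The sets
    [x i @^-1` U], for [i] in [lambda] and [U] basic open in [X i], are at most
    [lambda * kappa] many. Since [kappa] is infinite (a weight is at least
    aleph_0), the product is the larger of its two factors
    ([card_le_total], [card_setX_self]), hence below the splitting number
    ([card_lt_setX]). These sets are therefore not splitting: a single infinite
    [A] is, up to a finite set, inside or outside each of them
    ([unsplit_family]).

    This [A] works for every [i]. By sequential compactness some subsequence of
    [x i] along [A] has a limit [l], so every neighborhood of [l] is visited
    infinitely often along [A] ([seq_compact_cluster]). A basic open set around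
    [l] then cannot be almost avoided along [A], so [A] is almost contained in
    its preimage; thus all of [x i] along [A] converges to [l]
    ([unsplit_converges]). *)

Local Open Scope classical_set_scope.
Local Open Scope card_scope.

(** * Injections and comparability of cardinals *)

Lemma card_le_of_inj {T U : Type} (A : set T) (B : set U) (f : T -> U) :
  set_fun A B f -> set_inj A f -> A #<= B.
Proof.
move=> fAB finj; suff [g] : $|{injfun A >-> B}| by exact: inj_card_le g.
by apply/injfunPex; exists f.
Qed.

Lemma card_le_inj {T U : Type} (u0 : U) (A : set T) (B : set U) :
  A #<= B -> exists2 f : T -> U, set_fun A B f & set_inj A f.
Proof.
by elim/Ppointed: U => U in u0 B * => [|/pcard_leP/injfunPex//]; case: (no u0).
Qed.

(** A maximal partial injection between [A] and [B] is total on one of the two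
    sides, for otherwise one more pair could be added. *)
Lemma card_le_total {T U : Type} (A : set T) (B : set U) :
  A #<= B \/ B #<= A.
Proof.
pose part_inj (G : set (T * U)) :=
  (forall x y, G (x, y) -> A x /\ B y) /\
  (forall x y x' y', G (x, y) -> G (x', y') -> (x = x' <-> y = y')).
have [G [[GAB Ginj] Gmax]] : exists G, part_inj G /\
    forall H, G `<` H -> ~ part_inj H.
  apply: Zorn_bigcup => /= C CP Ctot; split.
    by move=> x y [G CG Gxy]; have [+ _] := CP _ CG; exact.
  move=> x y x' y' [G CG Gxy] [H CH Hxy].
  have [GH|HG] := Ctot _ _ CG CH.
    by have [_ +] := CP _ CH; apply=> //; exact: GH.
  by have [_ +] := CP _ CG; apply=> //; exact: HG.
have [domG|ndomG] := pselect (forall x, A x -> exists y, G (x, y)).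
  left; have [->|/set0P[x0 Ax0]] := eqVneq A set0; first exact: card_ge0.
  have [y0 _] := domG _ Ax0.
  have [f fP] : {f : T -> U & forall x, A x -> G (x, f x)}.
    apply: (@choice _ _ (fun x y => A x -> G (x, y))) => x.
    by have [/domG[y Gxy]|nAx] := pselect (A x); [exists y|exists y0].
  apply: (card_le_of_inj _ _ f) => [x /fP/GAB[]//|x x'].
  move=> /set_mem/fP Gx /set_mem/fP Gx' ff.
  by apply/(Ginj _ _ _ _ Gx Gx').
have [ranG|nranG] := pselect (forall y, B y -> exists x, G (x, y)).
  right; have [->|/set0P[y0 By0]] := eqVneq B set0; first exact: card_ge0.
  have [x0 _] := ranG _ By0.
  have [f fP] : {f : U -> T & forall y, B y -> G (f y, y)}.
    apply: (@choice _ _ (fun y x => B y -> G (x, y))) => y.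
    by have [/ranG[x Gxy]|nBy] := pselect (B y); [exists x|exists x0].
  apply: (card_le_of_inj _ _ f) => [y /fP/GAB[]//|y y'].
  move=> /set_mem/fP Gy /set_mem/fP Gy' ff.
  by apply/(Ginj _ _ _ _ Gy Gy').
exfalso.
move/existsNP: ndomG => [a /not_implyP[Aa Na]].
move/existsNP: nranG => [b /not_implyP[Bb Nb]].
apply: (Gmax (G `|` [set (a, b)])).
  split; first by move=> z; left.
  by move=> /(_ (a, b) (or_intror erefl)) Gab; apply: Na; exists b.
split=> [x y [/GAB//|[-> ->]]//|x y x' y' [Gx|[-> ->]] [Gx'|[-> ->]]//].
- exact: Ginj Gx Gx'.
- by split=> e; exfalso; [apply: Na; exists y; rewrite -e
                        |apply: Nb; exists x; rewrite -e].
- by split=> e; exfalso; [apply: Na; exists y'; rewrite e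
                        |apply: Nb; exists x'; rewrite e].
Qed.

(** * The square of an infinite cardinal *)

Definition pairing {T : Type} (B A : set T) (f : T -> T -> T) : Prop :=
  (forall x y, B x -> B y -> A (f x y)) /\
  (forall x y x' y', B x -> B y -> B x' -> B y' ->
    f x y = f x' y' -> x = x' /\ y = y').

(** Two distinct elements [p], [q] of [A] serve as bits: a point [x] of [B] is
    determined by its retract [r x] in [A] together with the bit telling whether
    [x] is in [A], so a self-pairing of [A] encodes pairs of points of a set [B]
    twice as large as [A]. *)
Lemma pairing_double {T : Type} (A B : set T) (f : T -> T -> T) (p q : T)
    (r : T -> T) :
  pairing A A f -> A p -> A q -> p <> q ->
  (forall x, B x -> A (r x)) ->
  (forall x y, B x -> B y -> (A x <-> A y) -> r x = r y -> x = y) ->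
  exists g, pairing B A g.
Proof.
move=> [fA finj] Ap Aq pq rA rinj.
pose c x := if `[< A x >] then p else q.
have cA x : A (c x) by rewrite /c; case: ifP.
have cP x y : c x = c y -> (A x <-> A y).
  rewrite /c; case: asboolP => Ax; case: asboolP => Ay // e.
  by case: pq; rewrite e.
exists (fun x y => f (f (r x) (r y)) (f (c x) (c y))); split.
  by move=> x y /rA rx /rA ry; apply: (fA); exact: fA.
move=> x y x' y' Bx By Bx' By'.
move: (rA _ Bx) (rA _ By) (rA _ Bx') (rA _ By') => rx ry rx' ry'.
move=> /(finj _ _ _ _ (fA _ _ rx ry) (fA _ _ (cA x) (cA y))
  (fA _ _ rx' ry') (fA _ _ (cA x') (cA y')))[].
move=> /(finj _ _ _ _ rx ry rx' ry')[ex ey].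
move=> /(finj _ _ _ _ (cA x) (cA y) (cA x') (cA y'))[/cP ax /cP ay].
by split; exact: rinj.
Qed.

(** Zorn's lemma for self-pairings ordered by extension. Functions are total on
    [T], so only their values on the domain matter and the order is merely a
    preorder. *)
Lemma maximal_pairing {T : Type} (A0 : set T) (f0 : T -> T -> T) :
  pairing A0 A0 f0 ->
  exists A f, [/\ A0 `<=` A, pairing A A f &
    forall B g, A `<=` B -> pairing B B g ->
      (forall x y, A x -> A y -> g x y = f x y) -> B `<=` A].
Proof.
move=> pf0.
pose P (s : set T * (T -> T -> T)) := A0 `<=` s.1 /\ pairing s.1 s.1 s.2.
pose R (s t : {s | P s}) := `[< (sval s).1 `<=` (sval t).1 /\
  forall x y, (sval s).1 x -> (sval s).1 y ->
    (sval t).2 x y = (sval s).2 x y >].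
have P0 : P (A0, f0) by split.
have [||C Ctot|[[A f] Pf] Amax] := @ZL_preorder _ (exist P _ P0) R.
- by move=> s; apply/asboolP; split.
- move=> r s t /asboolP[rs ers] /asboolP[st est]; apply/asboolP; split.
    exact: subset_trans st.
  by move=> x y rx ry; rewrite est ?ers //; exact: rs.
- have [->|/set0P[s0 Cs0]] := eqVneq C set0; first by exists (exist P _ P0).
  have common s t x y : C s -> C t -> (sval s).1 x -> (sval t).1 y ->
      exists u, [/\ C u, (sval u).1 x & (sval u).1 y].
    move=> Cs Ct sx ty; have [/asboolP[st _]|/asboolP[ts _]] := Ctot _ _ Cs Ct.
      by exists t; split=> //; exact: st.
    by exists s; split=> //; exact: ts.
  pose A x := exists2 s, C s & (sval s).1 x.
  (* The members of the chain agree where they are both defined, so they glue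
     to a single function on the union of their domains. *)
  have [f fP] : {f : T * T -> T & forall z s, C s -> (sval s).1 z.1 ->
      (sval s).1 z.2 -> f z = (sval s).2 z.1 z.2}.
    apply: (@choice _ _ (fun z v => forall s, C s -> (sval s).1 z.1 ->
      (sval s).1 z.2 -> v = (sval s).2 z.1 z.2)) => -[x y] /=.
    have [[s [Cs sx sy]]|nos] := pselect (exists s,
        [/\ C s, (sval s).1 x & (sval s).1 y]); last first.
      by exists x => s Cs sx sy; case: nos; exists s.
    exists ((sval s).2 x y) => t Ct tx ty.
    by have [/asboolP[_ ->]|/asboolP[_ ->]] := Ctot _ _ Cs Ct.
  have PA : P (A, fun x y => f (x, y)).
    split=> /= [x A0x|]; first by exists s0 => //; apply: (svalP s0).1.
    split=> [x y [s Cs sx] [t Ct ty]|].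
      have [u [Cu ux uy]] := common _ _ _ _ Cs Ct sx ty.
      exists u => //; rewrite (fP (x, y) u) //=.
      by have [_ [+ _]] := svalP u; exact.
    move=> x y x' y' [s Cs sx] [t Ct ty] [s' Cs' sx'] [t' Ct' ty'].
    have [u [Cu ux uy]] := common _ _ _ _ Cs Ct sx ty.
    have [u' [Cu' ux' uy']] := common _ _ _ _ Cs' Ct' sx' ty'.
    rewrite (fP (x, y) u) // (fP (x', y') u') //=.
    have [/asboolP[uu' e]|/asboolP[uu' e]] := Ctot _ _ Cu Cu'.
      by rewrite -e //; have [_ [_ +]] := svalP u'; apply=> //; exact: uu'.
    by rewrite -e //; have [_ [_ +]] := svalP u; apply=> //; exact: uu'.
  exists (exist P _ PA) => s Cs; apply/asboolP; split=> /= [x sx|x y sx sy].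
    by exists s.
  exact: (fP (x, y) s).
- have [/= A0A pf] := Pf; exists A, f; split=> // B g AB pg gf.
  have PB : P (B, g) by split=> //; exact: subset_trans AB.
  suff /asboolP[] : R (exist P _ PB) (exist P _ Pf) by [].
  by apply: Amax; apply/asboolP.
Qed.

(** Let [A] be the domain of a maximal self-pairing extending the one on a
    countable set. If the complement of [A] injects into [A], then [T] is at
    most twice as large as [A], and [pairing_double] encodes [T * T] in [A].
    Otherwise the complement contains a copy [h @` A] of [A], and the pairs of
    [A `|` h @` A] outside [A * A] can be encoded in this copy, against
    maximality. *)
Lemma card_setX_self {T : Type} :
  infinite_set [set: T] -> [set: T * T] #<= [set: T].
Proof.
move=> Tinf; have [t0 _] := infinite_setN0 Tinf.
move/infiniteP: Tinf => /(card_le_inj t0)[i _ iinj].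
have {}iinj m n : i m = i n -> m = n by apply: iinj; rewrite inE.
have [j jK] : {j : T -> nat & forall t n, i n = t -> j t = n}.
  apply: (@choice _ _ (fun t m => forall n, i n = t -> m = n)) => t.
  have [[m mt]|nom] := pselect (exists m, i m = t).
    by exists m => n; rewrite -mt => /iinj.
  by exists 0 => n nt; case: nom; exists n.
have [|A [f [iA pf Amax]]] :=
    maximal_pairing (range i) (fun x y => i (pickle (j x, j y))).
  split=> [x y _ _|_ _ _ _ [m _ <-] [n _ <-] [m' _ <-] [n' _ <-] /iinj].
    by exists (pickle (j x, j y)).
  move=> /(pcan_inj pickleK)[].
  by do ?rewrite (jK _ _ erefl); move=> -> ->.
have Ai n : A (i n) by apply: iA; exists n.
have i01 : i 0 <> i 1 by move/iinj.
suff [g [_ ginj]] : exists g, pairing [set: T] A g.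
  apply: (card_le_of_inj _ _ (fun z => g z.1 z.2)) => // -[x y] [x' y'] _ _ /=.
  by case/ginj=> // -> ->.
have [/(card_le_inj t0)[h hA hinj]|] := card_le_total (~` A) A.
  pose r x := if `[< A x >] then x else h x.
  apply: (pairing_double A _ f (i 0) (i 1) r) => //.
    by move=> x _; rewrite /r; case: asboolP => // /hA.
  move=> x y _ _; rewrite /r; case: asboolP => Ax; case: asboolP => Ay //.
  - by case=> /(_ Ax).
  - by case=> _ /(_ Ay).
  - by move=> _; apply: hinj; rewrite inE.
move=> /(card_le_inj t0)[h hA hinj]; exfalso.
have {}hinj x y : A x -> A y -> h x = h y -> x = y.
  by move=> Ax Ay; apply: hinj; rewrite inE.
pose B := A `|` h @` A.
have [k kK] : {k : T -> T & forall t x, A x -> h x = t -> k t = x}.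
  apply: (@choice _ _ (fun t y => forall x, A x -> h x = t -> y = x)) => t.
  have [[x [Ax xt]]|nox] := pselect (exists x, A x /\ h x = t).
    by exists x => y Ay; rewrite -xt => /esym/hinj ->.
  by exists t => x Ax xt; case: nox; exists x.
have [||g [gA ginj]] := pairing_double A B f (i 0) (i 1)
  (fun x => if `[< A x >] then x else k x) pf (Ai _) (Ai _) i01.
- by move=> x [Ax|[y Ay <-]]; case: asboolP => // _; rewrite (kK _ y).
- move=> x y Bx By; case: asboolP => Ax; case: asboolP => Ay //.
  + by case=> /(_ Ax).
  + by case=> _ /(_ Ay).
  + case: Bx => // -[u Au <-]; case: By => // -[v Av <-] _.
    by rewrite (kK _ u) // (kK _ v) // => ->.
(* New pairs are encoded in [A] by [g] and moved by [h] to the fresh copy, so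
   that their codes differ from those given by [f]. *)
pose F x y := if `[< A x /\ A y >] then f x y else h (g x y).
have [fA finj] := pf.
suff BA : B `<=` A.
  apply: (hA (i 0)) => //.
  by apply: BA; right; exists (i 0).
apply: (Amax B F).
- by move=> x; left.
- split=> [x y Bx By|x y x' y' Bx By Bx' By']; rewrite /F.
    case: asboolP => [[Ax Ay]|_]; first by left; exact: fA.
    by right; exists (g x y) => //; exact: gA.
  case: asboolP => [[Ax Ay]|_]; case: asboolP => [[Ax' Ay']|_].
  + exact: finj.
  + by move=> e; case: (hA (g x' y')); [exact: gA|rewrite -e; exact: fA].
  + by move=> e; case: (hA (g x y)); [exact: gA|rewrite e; exact: fA].
  + by move=> /hinj e; apply: ginj => //; apply: e; exact: gA.
- by move=> x y Ax Ay; rewrite /F; case: asboolP => // -[].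
Qed.

Lemma card_setX_le {T U K : Type} : infinite_set [set: K] ->
  [set: T] #<= [set: K] -> [set: U] #<= [set: K] -> [set: T * U] #<= [set: K].
Proof.
move=> Kinf; have [k0 _] := infinite_setN0 Kinf.
move=> /(card_le_inj k0)[f _ finj] /(card_le_inj k0)[g _ ginj].
apply: card_le_trans (card_setX_self Kinf).
apply: (card_le_of_inj _ _ (fun z => (f z.1, g z.2))) => // -[x y] [x' y'] _ _.
move=> [/finj fx /ginj gy].
by congr pair; [apply: fx|apply: gy]; rewrite inE.
Qed.

(** Whichever factor is the larger is infinite, as [U] is, and it absorbs the
    product. *)
Lemma card_lt_setX {T U V : Type} (S : set V) : infinite_set [set: U] ->
  [set: T] #< S -> [set: U] #< S -> [set: T * U] #< S.
Proof.
move=> Uinf [TS nST] [US nSU].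
suff [K [Kinf TK UK [KS nSK]]] : exists K : Type,
    [/\ infinite_set [set: K], [set: T] #<= [set: K], [set: U] #<= [set: K] &
        [set: K] #< S].
  have TUK := card_setX_le Kinf TK UK; split; first exact: card_le_trans KS.
  by move=> STU; apply: nSK; exact: card_le_trans TUK.
have [TU|UT] := card_le_total [set: T] [set: U].
  by exists U; split.
exists T; split=> //.
by apply/infiniteP; apply: card_le_trans UT; exact/infiniteP.
Qed.

(** * Families smaller than the splitting number *)

(** The members of a splitting family are required to be infinite, so the family
    is first cut down to its infinite members; a finite [S i] meets every [A] in
    a finite set anyway. *)
Lemma unsplit_family {I : Type} (S : I -> set nat) :
  [set: I] #< splitting_number ->
  exists2 A, infinite_set A &
    forall i, finite_set (A `&` S i) \/ finite_set (A `\` S i).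
Proof.
move=> [_ nle]; apply: contrapT => noA; apply: nle.
have [_ smin] := splitting_numberP.
pose F := S @` [set i | infinite_set (S i)].
apply: (@card_le_trans _ _ _ F); last first.
  by apply: card_le_trans (card_image_le _ _) _; exact: card_leT.
apply: smin; split=> [_ [i iS <-]//|A Ainf].
apply: contrapT => nsplit; apply: noA; exists A => // i.
have [fS|iS] := pselect (finite_set (S i)); first by left; exact: finite_setIr.
have [fI|iI] := pselect (finite_set (A `&` S i)); first by left.
have [fD|iD] := pselect (finite_set (A `\` S i)); first by right.
by case: nsplit; exists (S i) => //; exists i.
Qed.

(** * Convergence along a set of indices *)

Lemma within_eventuallyP (H P : set nat) :
  (within H \oo) P <-> finite_set (H `\` P).
Proof.
split=> [[N _ NP]|].
  apply: sub_finite_set (finite_II N) => n [Hn nPn] /=.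
  by rewrite ltnNge; apply/negP => /NP /= /(_ Hn).
move=> /finite_seqP[s sE]; exists (\max_(i <- s) i).+1 => // n /= sn Hn.
apply: contrapT => nPn.
have : (H `\` P) n by [].
rewrite sE /= => ns.
by move: sn; rewrite ltnNge (@leq_bigmax_seq nat s xpredT id n).
Qed.

Lemma converges_alongP {X : topologicalType} (x : nat -> X) (H : set nat) :
  converges_along x H <->
  exists l : X, forall U, nbhs l U -> finite_set (H `\` x @^-1` U).
Proof.
by split=> -[l lP]; exists l => U /lP/within_eventuallyP.
Qed.

(** Sequential compactness is applied to the subsequence of [x] along an
    injective enumeration [f] of part of [A]: the limit along an infinite [H] is
    a cluster point because all but finitely many [f n], [n] in [H], hit [U]. *)
Lemma seq_compact_cluster {X : topologicalType} (x : nat -> X) (A : set nat) :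
  seq_compact X -> infinite_set A ->
  exists l : X, forall U, nbhs l U -> infinite_set (A `&` x @^-1` U).
Proof.
move=> Xsc /infiniteP/(card_le_inj 0)[f fA finj].
have [H Hinf /converges_alongP[l lP]] := Xsc (x \o f).
exists l => U /lP finHU finAU.
have : finite_set (f @` (H `&` (x \o f) @^-1` U)).
  by apply: sub_finite_set finAU => _ [n [Hn Un] <-]; split=> //; exact: fA.
rewrite (eq_finite_set (inj_card_eq _)); last first.
  by move=> m n _ _; apply: finj; rewrite inE.
move=> finHI; apply: Hinf.
by rewrite -(setUIDK H ((x \o f) @^-1` U)) finite_setU.
Qed.

(** A basic neighborhood of a cluster point cannot have a finite trace on [A], so
    the alternative leaves only almost inclusion: a cluster point of an unsplit
    sequence is a limit. *)
Lemma unsplit_converges {X : topologicalType} (B : set (set X)) (x : nat -> X)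
    (A : set nat) :
  seq_compact X -> basis B -> infinite_set A ->
  (forall U, B U -> finite_set (A `&` x @^-1` U) \/
                    finite_set (A `\` x @^-1` U)) ->
  converges_along x A.
Proof.
move=> Xsc [Bopen Bnbhs] Ainf unsplit.
have [l lP] := seq_compact_cluster x A Xsc Ainf.
apply/converges_alongP; exists l => V /Bnbhs[U [BU Ul] UV].
have [finI|finD] := unsplit _ BU.
  case: (lP U) => //; apply: open_nbhs_nbhs; split=> //; exact: Bopen.
by apply: sub_finite_set finD => n [An nVn]; split=> // /UV.
Qed.

(** * Weight and simultaneous convergence *)

Lemma weight_infinite (X : topologicalType) : [set: nat] #<= weight X.
Proof.
by apply: (card_le_of_inj _ _ inl) => [n _|m n _ _ []//]; left; exists n.
Qed.

Lemma min_basis_le_weight (X : topologicalType) :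
  min_card (@basis X) #<= weight X.
Proof.
by apply: (card_le_of_inj _ _ inr) => [U BU|U V _ _ []//]; right; exists U.
Qed.

Theorem lemma4p7 (kappa : Type) (hkappa : [set: kappa] #< splitting_number)
    (lambda : Type) (hlambda : [set: lambda] #< splitting_number) :
  ssc lambda (fun X : topologicalType =>
    seq_compact X /\ weight X #<= [set: kappa]).
Proof.
move=> X x XP.
have [[i0 _]|nolambda] := pselect ([set: lambda] !=set0); last first.
  exists [set: nat]; first exact: infinite_nat.
  by move=> i; case: nolambda; exists i.
have kinf : infinite_set [set: kappa].
  have [_ wk] := XP i0; apply/infiniteP.
  exact: card_le_trans (weight_infinite (X i0)) wk.
have [k0 _] := infinite_setN0 kinf.
(* Enumerating each basis by [kappa], with the empty set as padding, lets the
   single type [lambda * kappa] index all the preimages. *)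
have basisK i : exists U : kappa -> set (X i),
    min_card (@basis (X i)) `<=` range U.
  have [_ wk] := XP i.
  have /(card_le_inj k0)[c _ cinj] :=
    card_le_trans (min_basis_le_weight (X i)) wk.
  pose U k := xget set0 [set V | min_card (@basis (X i)) V /\ c V = k].
  exists U => V BV; exists (c V) => //.
  have [BU cU] : min_card (@basis (X i)) (U (c V)) /\ c (U (c V)) = c V.
    by apply: (@xgetPex _ set0 [set W | _ W /\ c W = c V]); exists V.
  by apply: cinj => //; rewrite inE.
pose U i := projT1 (cid (basisK i)).
have UP i : min_card (@basis (X i)) `<=` range (U i) by rewrite /U; case: cid.
have [A Ainf unsplit] := unsplit_family
  (fun z : lambda * kappa => x z.1 @^-1` U z.1 z.2)
  (card_lt_setX _ kinf hlambda hkappa).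
exists A => // i; have [Xsc _] := XP i.
apply: (unsplit_converges (min_card (@basis (X i)))) => //.
  by have [] := min_card_basisP (X i).
by move=> _ /UP[k _ <-]; exact: (unsplit (i, k)).
Qed.
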